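(* (Chebyshev sieve.) Let $\mathscr{A}$ be a finite set of cardinality $N\ge 1$, and for each prime $p$ let $\mathscr{A}_p\subseteq\mathscr{A}$ be a subset. Suppose that for each prime $p$ we are given real numbers $0\leq\delta_p<1$ and $R_p$ with $|R_p|\leq N$ such that $$\#\mathscr{A}_p=\delta_pN+R_p .$$ For distinct primes $p,q$ define $R_{p,q}$ by $\#(\mathscr{A}_p\cap\mathscr{A}_q)=\delta_p\delta_qN+R_{p,q}$, and set $R_{p,p}:=R_p$. For a real number $z\geq1$ let $P(z)=\prod_{p\leq z}p$ (product over primes), and put $$N(a)=\#\{p\mid P(z): a\in\mathscr{A}_p\}\quad(a\in\mathscr{A}),\qquad M(z)=\frac1N\sum_{a\in\mathscr{A}}N(a),\qquad U(z)=\sum_{p\mid P(z)}\delta_p .$$ Assume $M(z)\neq0$, and let $E(\mathscr{A};z,\tfrac12M(z))$ denote the number of $a\in\mathscr{A}$ with $N(a)\leq\frac12M(z)$. Then $$E(\mathscr{A};z,\tfrac12M(z))\leq\frac{4N}{M(z)^2}\left(U(z)+\frac1N\sum_{p,q\mid P(z)}|R_{p,q}|+\frac{2U(z)}{N}\sum_{p\mid P(z)}|R_p|+\Bigl(\frac1N\sum_{p\mid P(z)}|R_p|\Bigr)^2\right).$$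
   Context: Sums over $p\mid P(z)$ run over primes $p\leq z$; the double sum over $p,q\mid P(z)$ runs over all ordered pairs $(p,q)$ of primes $\leq z$, including $p=q$. *)

(* Defs.v *)
From mathcomp Require Import all_boot all_order all_algebra.
From mathcomp Require Import reals.

Set Implicit Arguments.
Unset Strict Implicit.
Unset Printing Implicit Defensive.

Import Order.TTheory GRing.Theory Num.Theory.
Local Open Scope ring_scope.

(* [Num.truncn z] is the integer part of z for z >= 0 (and 0 for z < 0), so
   this is the product of the primes p <= z; see [mem_primes_primorial]. *)
Definition primorial (R : realType) (z : R) : nat :=
  (\prod_(0 <= p < (Num.truncn z).+1 | prime p) p)%N.

Lemma mem_primes_primorial (R : realType) (z : R) (p : nat) :
  (p \in primes (primorial z)) = prime p && (p%:R <= z).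
Proof.
rewrite mem_primes; case: (boolP (prime p)) => //= pr_p.
have P_gt0 : (0 < primorial z)%N by apply: prodn_cond_gt0 => q /prime_gt0.
rewrite P_gt0 /= /primorial (Euclid_dvd_prod _ _ _ pr_p).
have -> : (p%:R <= z) = (p < (Num.truncn z).+1)%N.
  case: p pr_p {P_gt0} => // p _.
  by rewrite ltnS -truncn_gt_nat.
apply/idP/idP => [|p_lt].
  rewrite big_has_cond => /hasP[q]; rewrite mem_index_iota => /andP[_ q_lt].
  by move=> /andP[pr_q]; rewrite dvdn_prime2 // => /eqP ->.
rewrite big_has_cond; apply/hasP; exists p; first by rewrite mem_index_iota.
by rewrite /= dvdnn andbT.
Qed.

Definition sieve_count (R : realType) (T : finType) (Ap : nat -> {set T})
    (z : R) (a : T) : nat :=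
  count (fun p => a \in Ap p) (primes (primorial z)).

Definition sieve_mean (R : realType) (T : finType) (A : {set T})
    (Ap : nat -> {set T}) (z : R) : R :=
  (#|A|%:R)^-1 * \sum_(a in A) (sieve_count Ap z a)%:R.

Definition sieve_density (R : realType) (delta : nat -> R) (z : R) : R :=
  \sum_(p <- primes (primorial z)) delta p.

(* R_{p,q}; on the diagonal it is R_p by convention. *)
Definition pair_remainder (R : realType) (T : finType) (A : {set T})
    (Ap : nat -> {set T}) (delta rem : nat -> R) (p q : nat) : R :=
  if p == q then rem p
  else #|Ap p :&: Ap q|%:R - delta p * delta q * #|A|%:R.

Definition sieve_exceptions (R : realType) (T : finType) (A : {set T})
    (Ap : nat -> {set T}) (z y : R) : nat :=
  #|[set a in A | (sieve_count Ap z a)%:R <= y]|.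

(* Main.v *)
(** Second moment method: an exceptional [a] satisfies [N(a) <= M/2], hence
    [(N(a) - M)^2 >= M^2/4], so it suffices to bound the variance
    [\sum_a (N(a) - M)^2]. Writing [M = U + S] with [S = N^-1 * \sum_p R_p],
    double counting gives it the exact value
    [N * \sum_p delta_p (1 - delta_p) + \sum_(p, q) R_(p,q) - 2 N U S - N S^2]. *)
Require Import Defs.
From mathcomp Require Import all_boot all_order all_algebra.
From mathcomp Require Import reals ring lra.

Set Implicit Arguments.
Unset Strict Implicit.
Unset Printing Implicit Defensive.

Import Order.TTheory GRing.Theory Num.Theory.
Local Open Scope ring_scope.

Lemma sum_mem_card (R : pzSemiRingType) (T : finType) (A B : {set T}) :
  B \subset A -> \sum_(a in A) (a \in B)%:R = #|B|%:R :> R.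
Proof.
move=> /setIidPr sBA; rewrite -natr_sum -big_mkcondr /= sum1_card.
by rewrite -{2}sBA; congr (_%:R); apply: eq_card => a; rewrite !inE.
Qed.

Section DoubleCounting.

Variables (R : pzSemiRingType) (T : finType) (I : eqType) (A : {set T}).
Variables (B : I -> {set T}) (r : seq I).
Hypothesis sBA : {in r, forall i, B i \subset A}.

Let countE (a : T) :
  (count (fun i => a \in B i) r)%:R = \sum_(i <- r) (a \in B i)%:R :> R.
Proof. by rewrite -sum1_count big_mkcond natr_sum; apply: eq_bigr => i _; case: ifP. Qed.

Lemma sum_count_mem :
  \sum_(a in A) (count (fun i => a \in B i) r)%:R
    = \sum_(i <- r) #|B i|%:R :> R.
Proof.
under eq_bigr do rewrite countE.
by rewrite exchange_big; apply: eq_big_seq => i /sBA/sum_mem_card.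
Qed.

(** The square of the count is the number of ordered pairs [(i, j)] from [r] with [a] in both sets;
    exchanging sums counts each pair by its intersection. *)
Lemma sum_count_mem_sqr :
  \sum_(a in A) (count (fun i => a \in B i) r)%:R ^+ 2
    = \sum_(i <- r) \sum_(j <- r) #|B i :&: B j|%:R :> R.
Proof.
under eq_bigr do rewrite countE expr2 big_distrlr /=.
rewrite exchange_big; apply: eq_big_seq => i ri.
rewrite exchange_big; apply: eq_bigr => j _.
rewrite -(sum_mem_card _ (subset_trans (subsetIl _ _) (sBA ri))).
by apply: eq_bigr => a _; rewrite inE -natrM mulnb.
Qed.

End DoubleCounting.

(** Chebyshev's inequality for the lower tail: a counted [a] has [m - f a >= m / 2 >= 0], so its
    square is at least [m ^+ 2 / 4]; every other term is nonnegative. *)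
Lemma card_le_half_second_moment (R : realFieldType) (T : finType)
    (A : {set T}) (f : T -> R) (m : R) : 0 <= m ->
  #|[set a in A | f a <= 2^-1 * m]|%:R * (m ^+ 2 / 4)
    <= \sum_(a in A) (f a - m) ^+ 2.
Proof.
move=> m_ge0; rewrite mulr_natl -sumr_const.
rewrite (eq_bigl (fun a => (a \in A) && (f a <= 2^-1 * m))); last first.
  by move=> a; rewrite inE.
rewrite big_mkcondr; apply: ler_sum => a _; case: ifP => [fa|_]; last exact: sqr_ge0.
nra.
Qed.

Lemma sum_sqr_sub (R : comPzRingType) (T : finType) (A : {set T})
    (f : T -> R) (m : R) :
  \sum_(a in A) (f a - m) ^+ 2
    = \sum_(a in A) f a ^+ 2 - 2 * m * \sum_(a in A) f a + m ^+ 2 * #|A|%:R.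
Proof.
rewrite mulr_sumr mulr_natr -sumr_const -sumrB -big_split /=.
by apply: eq_bigr => a _; ring.
Qed.

(** Off the diagonal this is the definition of [pair_remainder]. On it, [#|Ap p|] is
    [delta p * #|A| + rem p], whereas the product formula would give [delta p ^+ 2 * #|A| + rem p];
    the excess [delta p * (1 - delta p) * #|A|] is the last sum. By [uniq r] each [p] meets the
    diagonal exactly once. *)
Lemma sum_card_setI_remainder (R : realType) (T : finType) (A : {set T})
    (Ap : nat -> {set T}) (delta rem : nat -> R) (r : seq nat) :
    uniq r ->
    {in r, forall p, #|Ap p|%:R = delta p * #|A|%:R + rem p} ->
  \sum_(p <- r) \sum_(q <- r) #|Ap p :&: Ap q|%:R
    = (\sum_(p <- r) delta p) ^+ 2 * #|A|%:R
      + \sum_(p <- r) \sum_(q <- r) pair_remainder A Ap delta rem p q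
      + (\sum_(p <- r) delta p * (1 - delta p)) * #|A|%:R.
Proof.
move=> Ur cardAp; rewrite expr2 big_distrlr !mulr_suml -!big_split /=.
apply: eq_big_seq => p rp.
have Rpp : pair_remainder A Ap delta rem p p = rem p.
  by rewrite /pair_remainder eqxx.
rewrite !(bigD1_seq p rp Ur) /= Rpp setIid cardAp //.
rewrite (eq_bigr (fun q => delta p * delta q * #|A|%:R
                           + pair_remainder A Ap delta rem p q)).
  by rewrite big_split /= -mulr_suml; ring.
by move=> q /negPf qp; rewrite /pair_remainder eq_sym qp; ring.
Qed.

Theorem lemma3p1 (R : realType) (T : finType) (A : {set T})
    (Ap : nat -> {set T}) (delta rem : nat -> R) (z : R)
    (A_gt0 : (1 <= #|A|)%N)
    (sApA : forall p, prime p -> Ap p \subset A)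
    (delta_bounds : forall p, prime p -> 0 <= delta p < 1)
    (rem_bound : forall p, prime p -> `|rem p| <= #|A|%:R)
    (card_Ap : forall p, prime p ->
       #|Ap p|%:R = delta p * #|A|%:R + rem p)
    (z_ge1 : 1 <= z)
    (M_neq0 : sieve_mean A Ap z != 0) :
  let N : R := #|A|%:R in
  let M : R := sieve_mean A Ap z in
  let U : R := sieve_density delta z in
  let primesP : seq nat := primes (primorial z) in
  (sieve_exceptions A Ap z (2^-1 * M))%:R <=
    4 * N / M ^+ 2 *
      (U
       + N^-1 * \sum_(p <- primesP) \sum_(q <- primesP)
                  `|pair_remainder A Ap delta rem p q|
       + 2 * U / N * \sum_(p <- primesP) `|rem p|
       + (N^-1 * \sum_(p <- primesP) `|rem p|) ^+ 2).
Proof.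
cbv zeta.
set N : R := #|A|%:R; set M := sieve_mean A Ap z in M_neq0 *.
set U := sieve_density delta z; set r := primes (primorial z).
have prime_r : {in r, forall p, prime p}.
  by move=> p; rewrite mem_primes => /and3P[].
have sub_r : {in r, forall p, Ap p \subset A} by move=> p /prime_r/sApA.
have card_r : {in r, forall p, #|Ap p|%:R = delta p * N + rem p}.
  by move=> p /prime_r/card_Ap.
have N_gt0 : 0 < N by rewrite ltr0n.
have NV : N * N^-1 = 1 by rewrite divff ?gt_eqF.
set S := \sum_(p <- r) rem p; set S' : R := \sum_(p <- r) `|rem p|.
set Q : R := \sum_(p <- r) \sum_(q <- r) `|_|.
have U_ge0 : 0 <= U.
  by rewrite /U /sieve_density big_seq sumr_ge0 // => p /prime_r/delta_bounds/andP[].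
have leSS' : `|S| <= S' by exact: ler_norm_sum.
have sum_count : \sum_(a in A) (sieve_count Ap z a)%:R = N * M.
  by rewrite /M /sieve_mean mulrA NV mul1r.
have NM : N * M = U * N + S.
  rewrite -sum_count sum_count_mem // (eq_big_seq _ card_r) big_split.
  by rewrite -mulr_suml.
(* A mean of natural numbers is nonnegative, so [M_neq0] makes it positive. *)
have M_gt0 : 0 < M.
  by rewrite lt_def M_neq0 mulr_ge0 ?invr_ge0 ?ler0n ?sumr_ge0.
set D := \sum_(p <- r) delta p * (1 - delta p).
set Q0 := \sum_(p <- r) \sum_(q <- r) pair_remainder A Ap delta rem p q.
have variance : \sum_(a in A) ((sieve_count Ap z a)%:R - M) ^+ 2
    = U ^+ 2 * N + Q0 + D * N - N * M ^+ 2.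
  rewrite sum_sqr_sub sum_count sum_count_mem_sqr //.
  rewrite (sum_card_setI_remainder (primes_uniq _) card_r).
  by rewrite -/N -/Q0 -/D -/(sieve_density delta z) -/U; ring.
have leDU : D <= U.
  rewrite /D /U /sieve_density !big_seq; apply: ler_sum => p /prime_r pr_p.
  by have := delta_bounds p pr_p; nra.
have leQ : Q0 <= Q.
  by apply: ler_sum => p _; apply: ler_sum => q _; exact: ler_norm.
have := card_le_half_second_moment A
  (fun a => (sieve_count Ap z a)%:R) (ltW M_gt0).
rewrite variance -/(sieve_exceptions A Ap z (2^-1 * M)).
set E := (_%:R : R) => cheb.
(* With [M ^+ 2 / 4] as the denominator, clearing it leaves the left side of [cheb], so only the
   variance remains to be bounded. *)
have -> : 4 * N / M ^+ 2 * (U + N^-1 * Q + 2 * U / N * S' + (N^-1 * S') ^+ 2)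
    = (N * U + Q + 2 * U * S' + N * (N^-1 * S') ^+ 2) / (M ^+ 2 / 4).
  by field; rewrite !gt_eqF.
rewrite ler_pdivlMr ?divr_gt0 ?exprn_gt0 //.
apply: le_trans cheb _.
have MUS : M = U + N^-1 * S by apply: (mulfI (lt0r_neq0 N_gt0)); rewrite NM; field; rewrite gt_eqF.
(* Here the main term [U ^+ 2 * N] of the variance cancels. *)
have -> : N * M ^+ 2 = U ^+ 2 * N + 2 * U * S + N * (N^-1 * S) ^+ 2.
  by rewrite MUS; field; rewrite gt_eqF.
have sq_ge0 x : 0 <= N * x ^+ 2 by rewrite mulr_ge0 ?sqr_ge0 ?ltW.
(* [S] may be negative, so the cross term [- 2 * U * S] has to be absorbed by [2 * U * S']. *)
have US : - (U * S) <= U * S'.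
  by rewrite -mulrN ler_wpM2l // (le_trans _ leSS') // -normrN ler_norm.
(* The square of [S / N] enters the variance with a minus sign and that of [S' / N] enters the bound
   with a plus sign, so nonnegativity settles both. What is left is linear in the products already
   bounded. *)
have := sq_ge0 (N^-1 * S); have := sq_ge0 (N^-1 * S').
have : D * N <= N * U by rewrite mulrC ler_wpM2l // ltW.
lra.
Qed.
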